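(* For every integer $d\ge 2$ and every integer $q\ge 0$, the number $c_{d,q}$ of combinatorial classes of (real) dimension $q$ in the space $\Xi_d$ of monic and centered complex polynomial vector fields of degree $d$ is $$c_{d,q}=[t^q]\,{}_2F_1\bigl([1-d,\,2(1-d)];[2];t+t^2\bigr)=\sum_{n=0}^{d-1}\frac{(2-2d)_n(1-d)_n}{(2)_n\,n!}\binom{n}{q-n}.$$
   Context: Let $d\ge 2$. $\Xi_d\simeq\mathbb{C}^{d-1}$ is the space of vector fields $\xi_P=P(z)\frac{d}{dz}$ on $\mathbb{C}$ with $P(z)=z^d+a_{d-2}z^{d-2}+\dots+a_0$ a monic centered complex polynomial; trajectories are solutions of $\dot z=P(z)$ in real time. Separatrices. The point $\infty$ is a pole of order $d-2$ of $\xi_P$, and there are $2d-2$ trajectory directions at $\infty$, with asymptotic angles $\frac{2\pi\ell}{2d-2}$, $\ell\in\mathbb{Z}/(2d-2)$; those with $\ell$ even are incoming to $\infty$, those with $\ell$ odd are outgoing from $\infty$. The separatrix $s_\ell$ is the maximal trajectory with asymptotic direction $\ell$ at $\infty$. Every separatrix is either landing (its other end tends to an equilibrium point) or homoclinic (it joins $\infty$ to $\infty$); a homoclinic separatrix is written $s_{k,j}$, where $k$ odd and $j$ even are its two asymptotic directions. The end $e_\ell$ is $\infty$ with access between $s_{\ell-1}$ and $s_\ell$. The zones of $\xi_P$ are the connected components of $\mathbb{C}$ minus the closure of the union of all separatrices; an $\alpha\omega$-zone is a zone all of whose trajectories have the same $\alpha$-limit equilibrium point and the same $\omega$-limit equilibrium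 point, these two points being distinct. Each $\alpha\omega$-zone has on its boundary exactly one odd end $e_k$ and exactly one even end $e_j$ such that $s_k$ and $s_j$ are landing; the distinguished transversal $T_{k,j}$ of the zone joins these two ends. Combinatorial data. A combinatorial data set $(\iota,H,T)$ of degree $d$ consists of an involution $\iota$ of $\mathbb{Z}/(2d-2)$ and disjoint subsets $H,T\subset\mathbb{Z}/(2d-2)$ with $H\cup T=\{\ell:\iota(\ell)\neq\ell\}$ such that: (i) if $\iota(\ell)\ne\ell$ then $\ell$ and $\iota(\ell)$ have different parity; (ii) $\iota$ is non-crossing, i.e. the pairs $\{\ell,\iota(\ell)\}$ with $\iota(\ell)\ne \ell$ are pairwise non-crossing when $\mathbb{Z}/(2d-2)$ is placed in cyclic order on a circle; (iii) if $\iota(\ell)\neq\ell$, then $\ell,\iota(\ell)$ are both in $H$ or both in $T$. The data set of $\xi_P$ has as pairs in $H$ the $\{k,j\}$ for the homoclinic separatrices $s_{k,j}$, as pairs in $T$ the $\{k,j\}$ for the distinguished transversals $T_{k,j}$, and all other indices fixed by $\iota$. A combinatorial class in $\Xi_d$ is the set of all vector fields in $\Xi_d$ with a given combinatorial data set. It is known that every combinatorial data set of degree $d$ is realized by some $\xi_P\in\Xi_d$, and that each combinatorial class is a connected manifold in $\Xi_d$ of real dimension $q=2s+h$, where $h$ is the number of homoclinic separatrices (pairs in $H$) and $s$ is the number of $\alpha\omega$-zones (pairs in $T$). So $c_{d,q}$, the number of combinatorial classes of real dimension $q$ in $\Xi_d$, is the number of combinatorial data sets of degree $d$ with $2s+h=q$.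 Notation: $[t^q]F(t)$ is the coefficient of $t^q$ in $F$; ${}_2F_1([a,b];[c];z)=\sum_{n\ge0}\frac{(a)_n(b)_n}{(c)_n}\frac{z^n}{n!}$ with $(x)_n=x(x+1)\cdots(x+n-1)$, $(x)_0=1$ (a finite sum here since $1-d$ is a non-positive integer); $\binom{n}{m}=0$ if $m<0$ or $m>n$. *)

(* Defs.v *)
From HB Require Import structures.
From mathcomp Require Import all_boot all_order all_algebra.
From mathcomp Require Import boolp classical_sets functions cardinality reals.
From mathcomp Require Import topology normedtype derive trigo.
From mathcomp Require Import complex.

Set Implicit Arguments.
Unset Strict Implicit.
Unset Printing Implicit Defensive.

Import Order.TTheory GRing.Theory Num.Theory.
Import numFieldTopology.Exports numFieldNormedType.Exports.

Local Open Scope classical_set_scope.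
Local Open Scope ring_scope.

(* Z/(2d-2) is represented by its residues 0, ..., 2d-3; parity is well
   defined since 2d-2 is even. *)
Definition dir (d : nat) := 'I_(2 * d - 2).

Definition pre_data (d : nat) : Type :=
  ({ffun dir d -> dir d} * ({set dir d} * {set dir d}))%type.

(* Non-crossing: two pairs {a, i(a)} and {b, i(b)} cross on the circle iff,
   up to renaming, a < b < i(a) < i(b) as residues. *)
Definition is_comb_data (d : nat) (D : pre_data d) : bool :=
  let: (i, (H, T)) := D in
  [&& [forall l : dir d, i (i l) == l],
      [disjoint H & T],
      (H :|: T)%SET == [set l : dir d | i l != l]%SET,
      [forall l : dir d, (i l != l) ==> (odd l != odd (i l))],
      [forall a : dir d, forall b : dir d, ~~ [&& (a < b)%N, (b < i a)%N & (i a < i b)%N]] &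
      [forall l : dir d, (i l != l) ==>
         ((l \in H) && (i l \in H)) || ((l \in T) && (i l \in T))]].

Record comb_data (d : nat) := CombData {
  data_val :> pre_data d;
  _ : is_comb_data data_val
}.

HB.instance Definition _ (d : nat) := [isSub for @data_val d].
HB.instance Definition _ (d : nat) := [Finite of comb_data d by <:].

Definition invol (d : nat) (D : comb_data d) : dir d -> dir d :=
  fun l => (data_val D).1 l.
Definition Hset (d : nat) (D : comb_data d) : {set dir d} := (data_val D).2.1.
Definition Tset (d : nat) (D : comb_data d) : {set dir d} := (data_val D).2.2.

Definition npairs (d : nat) (D : comb_data d) (A : {set dir d}) : nat :=
  #|[set [set l; invol D l]%SET | l in A]%SET|.

Definition data_dim (d : nat) (D : comb_data d) : nat :=
  (2 * npairs D (Tset D) + npairs D (Hset D))%N.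

Definition num_data (d q : nat) : nat :=
  #|[set D : comb_data d | data_dim D == q]%SET|.

Section Dynamics.
Variable R : realType.

(* The phase space C is R * R, so that real-time curves in it can be
   differentiated over R. *)
Definition plane := (R * R)%type.

Definition plane_to_C (z : plane) : R[i] := Complex z.1 z.2.
Definition C_to_plane (w : R[i]) : plane := (complex.Re w, complex.Im w).

Definition vfield (P : {poly R[i]}) (z : plane) : plane :=
  C_to_plane P.[plane_to_C z].

Definition equilibrium (P : {poly R[i]}) (z : plane) : Prop :=
  root P (plane_to_C z).

Definition solution (P : {poly R[i]}) (I : set R) (g : R -> plane) : Prop :=
  forall t : R, I t -> is_derive t (1 : R) g (vfield P (g t)).

Definition polar (r theta : R) : plane := (r * cos theta, r * sin theta).

Definition modulus (z : plane) : R := Num.sqrt (z.1 ^+ 2 + z.2 ^+ 2).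

Definition to_infinity (F : set_system R) (theta : R) (g : R -> plane) : Prop :=
  ((fun t => modulus (g t)) @ F --> +oo) /\
  ((fun t => (modulus (g t))^-1 *: g t) @ F --> polar 1 theta).

Definition angle (d : nat) (l : R) : R := 2 * pi * l / (2 * d - 2)%:R.

(* Trajectories leave infinity along odd directions and reach it along even
   ones, in finite time since infinity is a pole.  Any piece of trajectory
   having infinity as its end in direction l lies on s_l. *)
Definition separatrix (d : nat) (P : {poly R[i]}) (l : nat) : set plane :=
  [set z | exists (g : R -> plane) (a b t : R),
     [/\ a < t < b, solution P `]a, b[ g, g t = z &
         if odd l then to_infinity (a^'+) (angle d l%:R) g
         else to_infinity (b^'-) (angle d l%:R) g]].

Definition landing (d : nat) (P : {poly R[i]}) (l : nat) : Prop :=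
  exists (g : R -> plane) (a : R) (x : plane), equilibrium P x /\
    if odd l then
      [/\ solution P `]a, +oo[ g, to_infinity (a^'+) (angle d l%:R) g &
          g t @[t --> +oo] --> x]
    else
      [/\ solution P `]-oo, a[ g, to_infinity (a^'-) (angle d l%:R) g &
          g t @[t --> -oo] --> x].

Definition homoclinic (d : nat) (P : {poly R[i]}) (k j : nat) : Prop :=
  exists (g : R -> plane) (a b : R),
    [/\ a < b, solution P `]a, b[ g,
        to_infinity (a^'+) (angle d k%:R) g &
        to_infinity (b^'-) (angle d j%:R) g].

Definition separatrices (d : nat) (P : {poly R[i]}) : set plane :=
  \bigcup_(l in `I_(2 * d - 2)) separatrix d P l.

Definition zone (d : nat) (P : {poly R[i]}) (Z : set plane) : Prop :=
  exists2 z : plane, ~ closure (separatrices d P) z &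
    Z = connected_component (~` closure (separatrices d P)) z.

Definition alpha_omega (P : {poly R[i]}) (Z : set plane) : Prop :=
  exists a b : plane,
    [/\ equilibrium P a, equilibrium P b, a <> b &
        forall z, Z z -> exists g : R -> plane,
          [/\ solution P setT g, g 0 = z,
              g t @[t --> -oo] --> a & g t @[t --> +oo] --> b]].

(* The end e_l is on the boundary of Z iff Z contains, near infinity, the ray
   halfway between the asymptotic directions of s_(l-1) and s_l. *)
Definition has_end (d : nat) (Z : set plane) (l : nat) : Prop :=
  \forall r \near +oo, Z (polar r (angle d (l%:R - 2^-1))).

Definition transversal (d : nat) (P : {poly R[i]}) (k j : nat) : Prop :=
  exists Z : set plane,
    [/\ zone d P Z, alpha_omega P Z,
        has_end d Z k /\ landing d P k & has_end d Z j /\ landing d P j].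

(* Xi_d = C^(d-1) in real coordinates: the real and the imaginary parts of
   (a_0, ..., a_(d-2)). *)
Definition Xi (d : nat) := ('rV[R]_d.-1 * 'rV[R]_d.-1)%type.

Definition Xi_poly (d : nat) (a : Xi d) : {poly R[i]} :=
  'X^d + \sum_(m < d.-1) Complex (a.1 ord0 m) (a.2 ord0 m) *: 'X^m.

Definition has_data (d : nat) (P : {poly R[i]}) (D : comb_data d) : Prop :=
  forall k j : dir d, odd k -> ~~ odd j ->
    ((k \in Hset D) && (invol D k == j) <-> homoclinic d P k j) /\
    ((k \in Tset D) && (invol D k == j) <-> transversal d P k j).

Definition comb_class (d : nat) (D : comb_data d) : set (Xi d) :=
  [set a | has_data (Xi_poly a) D].

(* Embedded submanifold of dimension m: near each of its points S is
   parametrized by an open set W of R^m, through a differentiable map having a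
   differentiable left inverse on the ambient space. *)
Definition submanifold (V : normedModType R) (S : set V) (m : nat) : Prop :=
  forall p, S p -> exists (U : set V) (W : set 'rV[R]_m)
      (f : 'rV[R]_m -> V) (g : V -> 'rV[R]_m),
    [/\ open U /\ U p, open W /\ f @` W = S `&` U,
        forall x, W x -> g (f x) = x,
        forall x, W x -> differentiable f x &
        forall y, U y -> differentiable g y].

Definition comb_classes (d q : nat) : set (set (Xi d)) :=
  [set S | exists D : comb_data d,
     [/\ S = comb_class D, S !=set0 & submanifold S q]].

End Dynamics.

Arguments comb_class R {d} D.
Arguments comb_classes R d q : clear implicits.

Definition pochhammer (x : rat) (n : nat) : rat := \prod_(i < n) (x + i%:R).

(* 2F1([-m, b]; [c]; z) as a polynomial in z: the terms with n > m vanish. *)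
Definition hyp2F1 (m : nat) (b c : rat) : {poly rat} :=
  \sum_(n < m.+1)
    (pochhammer (- m%:R) n * pochhammer b n / (pochhammer c n * n`!%:R)) *: 'X^n.

Definition binz (n : nat) (m : int) : nat :=
  if m is Posz k then 'C(n, k) else 0%N.

(* Main.v *)
From HB Require Import structures.
Require Import Defs.
From mathcomp Require Import all_boot all_order all_algebra.
From mathcomp Require Import ring lra zify.

(**
  A data set is a noncrossing partial matching of the 2d-2 points of a line,
  with arcs labelled H (weight t) or T (weight t^2), so the generating
  polynomial of the dimension is a polynomial in x = t + t^2 whose coefficient
  of x^n counts the matchings with n arcs joining points of opposite parity.
  Decomposing at the first point gives the recursion
    A_(L+1) = A_L + x * \sum_(k < L, k even) A_k * A_(L-1-k).
  An arc joins points of opposite parity iff it encloses an even number of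
  points, so the matching is admissible iff each region cut out by the arcs
  contains an even number of unmatched points.  Reading the line from left to
  right with a stack of parities, one for each open region, the number of
  completions of a stack depends only on its numbers a, b of even and odd
  entries; this turns the quadratic recursion for A into a linear one, solved by
  an explicit product formula, which for a = 1 and b = 0 reads
    'C(2m, n) * 'C(m, n) / (n + 1),  m = d - 1.

  A class determines its data set, since the homoclinic separatrices and
  the transversals list all pairs; a nonempty class has only one dimension
  because the differential of a change of parametrization is invertible.
*)

Set Implicit Arguments.
Unset Strict Implicit.
Unset Printing Implicit Defensive.

Import Order.TTheory GRing.Theory Num.Theory.

Local Open Scope ring_scope.

(** * Generating polynomials of the words of matchings *)

(* The stack s lists, innermost first, the parities (true for odd) of the
   numbers of unmatched points met so far in the open regions.  wordgf L s
   enumerates, by number of openings, the words of L letters emptying s: an even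
   region can be closed, and every letter may also be an unmatched point or the
   opening of a new region. *)
Fixpoint wordgf (L : nat) (s : seq bool) : {poly rat} :=
  match L, s with
  | 0, [::] => 1
  | L'.+1, false :: s' =>
      wordgf L' s' + wordgf L' (true :: s') + 'X * wordgf L' [:: false, false & s']
  | L'.+1, true :: s' =>
      wordgf L' (false :: s') + 'X * wordgf L' [:: false, true & s']
  | _, _ => 0
  end.

(** The entries of [t] stay untouched until [s] is emptied, and an empty stack accepts no letter, so
    a word splits uniquely where [s] becomes empty. *)
Lemma wordgf_cat L s t :
  wordgf L (s ++ t) = \sum_(i < L.+1) wordgf i s * wordgf (L - i) t.
Proof.
elim: L s => [|L IH] [|[] s].
- by rewrite big_ord1 mul1r.
- by rewrite big_ord1 mul0r.
- by rewrite big_ord1 mul0r.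
- by rewrite big_ord_recl /= mul1r big1 ?addr0 // => i _; rewrite mul0r.
- rewrite big_ord_recl /= mul0r add0r (IH (false :: s)) (IH [:: false, true & s]).
  rewrite mulr_sumr -big_split; apply: eq_bigr => i _ /=.
  by rewrite subSS mulrDl mulrA.
- rewrite big_ord_recl /= mul0r add0r (IH s) (IH (true :: s)).
  rewrite (IH [:: false, false & s]) mulr_sumr -!big_split; apply: eq_bigr => i _ /=.
  by rewrite subSS !mulrDl mulrA.
Qed.

(* With y marking letters, an even entry contributes W / (1 - W^2) and an odd one
   W^2 / (1 - W^2), where W = y * (1 + x * W^2 / (1 - W^2)).  The formula is
   Lagrange inversion applied to the product of a even and b odd entries.  For
   a = b = k = 0 < r it has a zero denominator and the value 0 is the right one. *)
Definition wordnum (a b k r : nat) : rat :=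
  let L := (a + 2 * b + 2 * k + 2 * r)%N in
  if L == 0%N then 1 else
  'C(L, k)%:R * 'C((a + b + k + r).-1, r)%:R * ((a + b)%:R * L%:R - k%:R * a%:R)
  / (L%:R * (a + b + k)%:R).

(** The upper index in the form [n + k] avoids truncated subtraction, so [field] can finish once
    neighbouring binomials are reduced to a common one. *)
Lemma binrS (n k : nat) : 'C(n + k, k.+1)%:R = 'C(n + k, k)%:R * n%:R / k.+1%:R :> rat.
Proof.
have := mul_bin_left (n + k) k; rewrite addnK => /(congr1 (fun x => x%:R : rat)).
rewrite !natrM => H.
have k0 : k.+1%:R != 0 :> rat by rewrite pnatr_eq0.
by apply: (canRL (mulfK k0)); rewrite mulrC H mulrC.
Qed.

Lemma binrSS (n k : nat) :
  'C((n + k).+1, k.+1)%:R = 'C(n + k, k)%:R * (n + k).+1%:R / k.+1%:R :> rat.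
Proof.
have := mul_bin_diag (n + k).+1 k => /(congr1 (fun x => x%:R : rat)).
rewrite !natrM /= => H.
have k0 : k.+1%:R != 0 :> rat by rewrite pnatr_eq0.
by apply: (canRL (mulfK k0)); rewrite mulrC -H mulrC.
Qed.

(** This is the step of [wordgf] at an odd top, read on counts. A shortest word spends one letter
    per even entry and two per odd entry or opening ([k] openings); the surplus [2 * r] consists of
    further unmatched points. *)
Lemma wordnum_true a b k r :
  wordnum a b.+1 k r = wordnum a.+1 b k r +
     (if k is k'.+1 then wordnum a.+1 b.+1 k' r else 0).
Proof.
have [[a0 b0] r0] := (ler0n rat a, ler0n rat b, ler0n rat r).
case: k => [|k]; rewrite /wordnum ?mulnS ?addnS ?addSn /=.
  rewrite !bin0 !addn0 ?muln0 ?addn0; field.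
  by repeat (apply/andP; split); apply: lt0r_neq0; lra.
have k0 := ler0n rat k.
set M := (a + 2 * b + 2 * k + 2 * r)%N.
have -> : M.+3 = ((a + 2 * b + k + 2 * r).+3 + k)%N by rewrite /M; lia.
rewrite binrSS binrS; field.
by repeat (apply/andP; split); apply: lt0r_neq0; lra.
Qed.

Lemma wordnum_false a b k r :
  wordnum a.+1 b k r = wordnum a b k r + (if r is r'.+1 then wordnum a b.+1 k r' else 0) +
     (if k is k'.+1 then wordnum a.+2 b k' r else 0).
Proof.
have [a0 b0] := (ler0n rat a, ler0n rat b).
case: k => [|k]; [|have k0 := ler0n rat k];
  (case: r => [|r]; [|have r0 := ler0n rat r]);
  rewrite /wordnum ?mulnS ?addnS ?addSn /= ?addn0 ?muln0 ?addn0 ?bin0.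
- case: eqP => [H|/eqP H].
    by have [-> ->] : a = 0%N /\ b = 0%N by lia.
  have : (0 < (a + b)%:R :> rat) by rewrite ltr0n; lia.
  rewrite natrD => ab0; field.
  by repeat (apply/andP; split); apply: lt0r_neq0; lra.
- rewrite binrSS binrS.
  (* Here [k = 0], so [a + b = 0] makes the denominator of the first summand vanish; that summand is
     then 0. *)
  have [H|H] := posnP (a + b).
    have [-> ->] : a = 0%N /\ b = 0%N by lia.
    rewrite !mulr0 !mul0r !addn0; field.
    by repeat (apply/andP; split); apply: lt0r_neq0; lra.
  move: H; rewrite -(ltr0n rat) natrD => ab0; field.
  by repeat (apply/andP; split); apply: lt0r_neq0; lra.
- set M := (a + 2 * b + 2 * k)%N.
  have -> : M.+2 = ((a + 2 * b + k).+2 + k)%N by rewrite /M; lia.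
  rewrite binrSS binrS; field.
  by repeat (apply/andP; split); apply: lt0r_neq0; lra.
- have -> : (a + b + k + r).+1 = ((a + b + k).+1 + r)%N by lia.
  rewrite binrSS binrS.
  set M := (a + 2 * b + 2 * k + 2 * r)%N.
  have -> : M.+4 = ((a + 2 * b + k + 2 * r).+4 + k)%N by rewrite /M; lia.
  rewrite binrSS binrS; field.
  by repeat (apply/andP; split); apply: lt0r_neq0; lra.
Qed.

Lemma coef_wordgf L s k :
  (wordgf L s)`_k =
  let a := count negb s in let b := count id s in
  if (a + 2 * b + 2 * k <= L)%N && ~~ odd (L - a) then
    wordnum a b k (L - (a + 2 * b + 2 * k))./2 else 0.
Proof.
elim: L s k => [|L IH] [|[] s] k /=.
- case: k => [|k]; rewrite coef1 //=.
- by rewrite coef0; case: ifP => //; lia.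
- by rewrite coef0.
(* Letters remain on an empty stack: the branch of value 1 is not taken, and the numerator vanishes
   as [a = b = 0]. *)
- rewrite coef0; case: ifP => // H; rewrite /wordnum ifF; last lia.
  by rewrite !addn0 !mul0r mulr0n mulr0 subr0 mulr0 mul0r.
- rewrite coefD coefXM !IH /=.
  move: (count negb s) (count id s) => a b.
  rewrite !add0n !add1n.
  have [H|H] := boolP ((a + 2 * b.+1 + 2 * k <= L.+1)%N && ~~ odd (L.+1 - a)).
    rewrite [in RHS]wordnum_true; congr (_ + _).
      by rewrite ifT; [congr (wordnum _ _ _ (half _))|]; lia.
    by case: k H => [|k] H //=; rewrite ifT; [congr (wordnum _ _ _ (half _))|]; lia.
  rewrite ifF; last lia.
  by case: k H => [|k] H /=; rewrite ?addr0 // add0r ifF //; lia.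
- rewrite !coefD coefXM !IH /=.
  move: (count negb s) (count id s) => a b.
  rewrite !add0n !add1n.
  have [H|H] := boolP ((a.+1 + 2 * b + 2 * k <= L.+1)%N && ~~ odd (L.+1 - a.+1)).
    rewrite [in RHS]wordnum_false; congr (_ + _ + _).
    + case E: (half (L.+1 - (a.+1 + 2 * b + 2 * k))) => [|r].
        by rewrite ifF //; lia.
      by rewrite ifT; [congr (wordnum _ _ _ _)|]; lia.
    + by case: k H => [|k] H //=; rewrite ifT; [congr (wordnum _ _ _ (half _))|]; lia.
  by case: k H => [|k] H /=; do !(rewrite ifF; last lia); rewrite ?addr0.
Qed.

(* The outer region is closed by one additional letter. *)
Definition matchgf L := wordgf L.+1 [:: odd L].

Lemma matchgf0 : matchgf 0 = 1.
Proof. by rewrite /matchgf /= mulr0 !addr0. Qed.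

Lemma wordgf_parity L s : odd L != odd (count negb s) -> wordgf L s = 0.
Proof.
by move=> H; apply/polyP => k; rewrite coef_wordgf coef0 /= ifF //; lia.
Qed.

(** The first letter is an unmatched point, which flips the outer parity, or opens an arc. Closing
    the outer region at once would leave letters on an empty stack. *)
Lemma matchgfS L :
  matchgf L.+1 = matchgf L +
    'X * \sum_(k < L | ~~ odd k) matchgf k * matchgf (L.-1 - k).
Proof.
have -> : matchgf L.+1 = matchgf L + 'X * wordgf L.+1 [:: false; ~~ odd L].
  rewrite /matchgf -[in LHS]/(odd L.+1) [odd L.+1]/=.
  case: (odd L) => //.
  by rewrite [wordgf L.+2 _]/= add0r.
congr (_ + 'X * _).
(* The extreme terms vanish, as no nonempty stack is emptied by zero letters. In the others the arc
   encloses [i] points and letter [i.+1] closes it; odd [i] contributes 0 by parity. *)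
rewrite (wordgf_cat _ [:: false] [:: _]) big_ord_recl mul0r add0r big_ord_recr /=.
rewrite subSS subnn mulr0 addr0 [RHS]big_mkcond; apply: eq_bigr => i _ /=.
have iL := ltn_ord i.
case: ifP => oi.
  rewrite /matchgf (negbTE oi) subSS; congr (_ * _).
  have -> : (L - i = (L.-1 - i).+1)%N by lia.
  by congr (wordgf _ [:: _]); lia.
by rewrite -[X in X * _]/(wordgf i.+1 [:: false]) wordgf_parity ?mul0r //=; lia.
Qed.

Lemma matchgf_double m k :
  (matchgf (2 * m))`_k = 'C(2 * m, k)%:R * 'C(m, k)%:R / k.+1%:R.
Proof.
rewrite /matchgf coef_wordgf /=.
have -> : odd (2 * m) = false by lia.
case: ifP => H; last by rewrite [in RHS](@bin_small m) ?mulr0 ?mul0r //; lia.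
rewrite /= addn0 in H *.
have -> : ((2 * m).+1 - (1 + 2 * k))./2%N = (m - k)%N by lia.
rewrite /wordnum.
have -> : (1 + 2 * 0 + 2 * k + 2 * (m - k) = (2 * m).+1)%N by lia.
have -> : ((1 + 0 + k + (m - k)).-1 = m)%N by lia.
rewrite bin_sub; last lia.
have k0 := ler0n rat k.
(* This removes the subtractions; then ['C(2m + 1, k)] is rewritten through ['C(2m, k)]. *)
have [d ->] : exists d, m = (d + k)%N by exists (m - k)%N; lia.
have d0 := ler0n rat d.
have := mul_bin_down (2 * (d + k)).+1 k.
have -> : ((2 * (d + k)).+1 - k = (2 * d + k).+1)%N by lia.
move=> /(congr1 (fun x => x%:R : rat)); rewrite !natrM => E.
have -> : 'C((2 * (d + k)).+1, k)%:R =
    (2 * (d + k)).+1%:R * 'C(2 * (d + k), k)%:R / (2 * d + k).+1%:R :> rat.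
  by rewrite E mulrC mulKf // pnatr_eq0.
rewrite /=; field.
by repeat (apply/andP; split); apply: lt0r_neq0; lra.
Qed.

(** * Noncrossing matchings as trees *)

Local Open Scope nat_scope.

(* Arc b t1 t2 has t1 inside the arc and t2 to its right; b is true for T and
   false for H. *)
Inductive tree := Leaf | Dot of tree | Arc of bool & tree & tree.

Lemma tree_comparable : comparable tree.
Proof. rewrite /comparable /decidable; decide equality; exact: Bool.bool_dec. Qed.

HB.instance Definition _ := comparableMixin tree_comparable.

Fixpoint tsize t :=
  match t with
  | Leaf => 0
  | Dot t => (tsize t).+1
  | Arc _ t1 t2 => (tsize t1 + tsize t2).+2
  end.

Fixpoint even_arcs t :=
  match t with
  | Leaf => true
  | Dot t => even_arcs t
  | Arc _ t1 t2 => [&& ~~ odd (tsize t1), even_arcs t1 & even_arcs t2]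
  end.

Fixpoint weight t :=
  match t with
  | Leaf => 0
  | Dot t => weight t
  | Arc b t1 t2 => (b.+1 + weight t1 + weight t2)%N
  end.

(* The partner of x, with its label, in t drawn on p, p + 1, ...; an unmatched
   point is its own partner, with label false. *)
Fixpoint mate t p x : nat * bool :=
  match t with
  | Leaf => (x, false)
  | Dot t => if x == p then (x, false) else mate t p.+1 x
  | Arc b t1 t2 =>
      let q := p.+1 + tsize t1 in
      if x == p then (q, b) else if x == q then (p, b)
      else if x < q then mate t1 p.+1 x else mate t2 q.+1 x
  end.

(** The label is normalised at fixed points, as in [mate], so that [f] can be recovered exactly from
    a tree. *)
Definition matching (p q : nat) (f : nat -> nat * bool) : Prop :=
  (forall x, p <= x < q ->
     [/\ p <= (f x).1 < q, f (f x).1 = (x, (f x).2),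
         (f x).1 = x -> (f x).2 = false
       & (f x).1 <> x -> odd x != odd (f x).1]) /\
  (forall x y, p <= x < q -> p <= y < q ->
     ~~ [&& x < y, y < (f x).1 & (f x).1 < (f y).1]).

Lemma mate_dot0 t p : mate (Dot t) p p = (p, false).
Proof. by rewrite /= eqxx. Qed.

Lemma mate_dot t p x : x != p -> mate (Dot t) p x = mate t p.+1 x.
Proof. by move=> /negbTE /= ->. Qed.

Lemma mate_open b t1 t2 p : mate (Arc b t1 t2) p p = (p.+1 + tsize t1, b).
Proof. by rewrite /= eqxx. Qed.

Lemma mate_close b t1 t2 p : mate (Arc b t1 t2) p (p.+1 + tsize t1) = (p, b).
Proof. by rewrite /= eqxx ifF //; lia. Qed.

Lemma mate_inside b t1 t2 p x :
  p < x < p.+1 + tsize t1 -> mate (Arc b t1 t2) p x = mate t1 p.+1 x.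
Proof.
move=> H /=; case: eqP => [|_]; first by lia.
by case: eqP => [|_]; [lia|rewrite ifT //; lia].
Qed.

Lemma mate_after b t1 t2 p x :
  p.+1 + tsize t1 < x -> mate (Arc b t1 t2) p x = mate t2 (p.+1 + tsize t1).+1 x.
Proof.
move=> H /=; case: eqP => [|_]; first by lia.
by case: eqP => [|_]; [lia|rewrite ifF //; lia].
Qed.

Arguments mate : simpl never.

Variant arc_spec p q r x : Prop :=
  | ArcOpen of x = p
  | ArcInside of p < x < q
  | ArcClose of x = q
  | ArcAfter of q < x < r.

Lemma arcP p q r x : p < q -> p <= x < r -> arc_spec p q r x.
Proof.
move=> pq xr.
have [xp|xp|] := ltngtP x p; first by lia.
  have [xq|xq|] := ltngtP x q.
  - by apply: ArcInside; lia.
  - by apply: ArcAfter; lia.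
  - exact: ArcClose.
exact: ArcOpen.
Qed.

(** The root arc, its inside and its right side are each stable under [mate], so only two arcs of
    the same subtree could cross. *)
Lemma mate_matching t p : even_arcs t -> matching p (p + tsize t) (mate t p).
Proof.
elim: t p => [|t IH|b t1 IH1 t2 IH2] p.
- by move=> _; split=> [x|x y] /=; lia.
- have -> : tsize (Dot t) = (tsize t).+1 by [].
  move=> /(IH p.+1)[{}IH nc]; split.
  + move=> x xp; have [->|xNp] := eqVneq x p.
      by rewrite mate_dot0 mate_dot0; split=> //=; lia.
    rewrite (mate_dot _ xNp).
    have /IH[r1 r2 r3 r4] : p.+1 <= x < p.+1 + tsize t by lia.
    by rewrite mate_dot; [split=> //; lia|lia].
  + move=> x y xp yp; have := nc x y.
    have [->|xNp] := eqVneq x p; first by rewrite mate_dot0 /=; lia.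
    have [->|yNp] := eqVneq y p; first by rewrite mate_dot0 /=; lia.
    by rewrite !mate_dot //; apply; lia.
- have -> : tsize (Arc b t1 t2) = (tsize t1 + tsize t2).+2 by [].
  move=> /and3P[e1 /(IH1 p.+1)[{}IH1 nc1] /(IH2 (p.+1 + tsize t1).+1)[{}IH2 nc2]].
  have pq : p < p.+1 + tsize t1 by lia.
  have r : p + (tsize t1 + tsize t2).+2 = (p.+1 + tsize t1).+1 + tsize t2 by lia.
  split.
  + move=> x /(arcP pq)[->|H|->|H].
    * by rewrite mate_open mate_close; split=> //=; lia.
    * have [r1 r2 r3 r4] := IH1 _ H.
      by rewrite !mate_inside //; split=> //; lia.
    * by rewrite mate_close mate_open; split=> //=; lia.
    * rewrite r in H; have [r1 r2 r3 r4] := IH2 _ H.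
      by rewrite !mate_after; try lia; split=> //; lia.
  + move=> x y /(arcP pq)[->|H|->|H] /(arcP pq)[->|G|->|G];
    rewrite ?mate_open ?mate_close /=; try lia.
    * by rewrite mate_inside //; have [] := IH1 _ G; lia.
    * by rewrite !mate_inside //; exact: nc1.
    * by rewrite mate_inside //; have [] := IH1 _ H; lia.
    * by rewrite r in G H; rewrite !mate_after; try lia; exact: nc2.
Qed.

(** The partner of [p] determines the root constructor and the sizes of the subtrees. *)
Lemma eq_mate t t' p : tsize t = tsize t' ->
  (forall x, p <= x < p + tsize t -> mate t p x = mate t' p x) ->
  even_arcs t -> even_arcs t' -> t = t'.
Proof.
elim: t t' p => [|t IH|b t1 IH1 t2 IH2] [|t'|b' t1' t2'] p //=.
- case=> Et H et et'; congr Dot; apply: (IH _ p.+1) => // x xp.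
  have /H : p <= x < p + (tsize t).+1 by lia.
  by rewrite !mate_dot //; lia.
- move=> Et H; have := H p ltac:(lia).
  by rewrite mate_dot0 mate_open => -[]; lia.
- move=> Et H; have := H p ltac:(lia).
  by rewrite mate_dot0 mate_open => -[]; lia.
- move=> Et H /and3P[_ e1 e2] /and3P[_ e1' e2'].
  have [Es Eb] : tsize t1 = tsize t1' /\ b = b'.
    by have := H p ltac:(lia); rewrite !mate_open => -[]; lia.
  rewrite Eb in H *.
  congr Arc; [apply: (IH1 _ p.+1)|apply: (IH2 _ (p.+1 + tsize t1).+1)] => //.
  + move=> x xp; have := H x ltac:(lia).
    by rewrite !mate_inside //; lia.
  + by lia.
  + move=> x xp; have := H x ltac:(lia).
    by rewrite !mate_after -?Es //; lia.
Qed.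

Lemma mate_surj p n f : matching p (p + n) f ->
  exists t, [/\ tsize t = n, even_arcs t &
                forall x, p <= x < p + n -> mate t p x = f x].
Proof.
elim/ltn_ind: n p => -[|n] IH p [fP nc].
  by exists Leaf; split=> // x; lia.
have [r1 r2 r3 r4] := fP p ltac:(lia).
case: (eqVneq (f p).1 p) => fp.
  have [|t [tn te tf]] := IH n (ltnSn _) p.+1.
    split=> [x xp|x y xp yp]; last by apply: nc; lia.
    have [s1 s2 s3 s4] := fP x ltac:(lia); split=> //.
    suff : (f x).1 <> p by lia.
    by move=> E; move: s2; rewrite E => s2; rewrite s2 /= in fp; lia.
  exists (Dot t); split=> //=; first by rewrite tn.
  move=> x xp; have [->|xNp] := eqVneq x p; last by rewrite mate_dot //; apply: tf; lia.
  by rewrite mate_dot0 [f p]surjective_pairing fp r3.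
have [b fpE] : exists b, f p = ((f p).1, b) by exists (f p).2; case: (f p).
move: fpE; set q := (f p).1 => fpE.
have fq : f q = (p, b) by rewrite r2 fpE.
have [|t1 [tn1 te1 tf1]] := IH (q - p.+1) ltac:(lia) p.+1.
  split=> [x xp|x y xp yp]; last by apply: nc; lia.
  have [s1 s2 s3 s4] := fP x ltac:(lia); split=> //.
  have := nc p x; rewrite -/q.
  have xp' : (f x).1 <> p by move=> E; move: s2; rewrite E fpE => -[]; lia.
  have xq' : (f x).1 <> q by move=> E; move: s2; rewrite E fq => -[]; lia.
  by lia.
have [|t2 [tn2 te2 tf2]] := IH (n - (q - p)) ltac:(lia) q.+1.
  split=> [x xp|x y xp yp]; last by apply: nc; lia.
  have [s1 s2 s3 s4] := fP x ltac:(lia); split=> //.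
  (* Non-crossing is applied to the partner of [x]: were it inside the arc from [p] to [q], its own
     partner [x] would lie beyond [q]. *)
  have := nc p (f x).1; rewrite -/q s2.
  have xp' : (f x).1 <> p by move=> E; move: s2; rewrite E fpE => -[]; lia.
  have xq' : (f x).1 <> q by move=> E; move: s2; rewrite E fq => -[]; lia.
  by rewrite /=; lia.
exists (Arc b t1 t2).
have E : p.+1 + tsize t1 = q by lia.
split=> [/=||x xp].
- by lia.
- by rewrite /= te1 te2 !andbT; lia.
- have pq : p < p.+1 + tsize t1 by lia.
  have [->|H|->|H] := arcP pq xp.
  + by rewrite mate_open E.
  + by rewrite mate_inside // tf1 //; lia.
  + by rewrite mate_close E.
  + by rewrite mate_after ?E ?tf2 //; lia.
Qed.

(** Each arc is counted once, at its left end. *)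
Lemma weight_mate t p :
  weight t = \sum_(p <= x < p + tsize t | x < (mate t p x).1) (mate t p x).2.+1.
Proof.
elim: t p => [|t IH|b t1 IH1 t2 IH2] p.
- by rewrite addn0 big_geq.
- rewrite /= addnS big_ltn_cond ?leq_addr ?ltnS ?leq_addr //.
  rewrite mate_dot0 ltnn -addSn (IH p.+1).
  rewrite big_nat_cond [RHS]big_nat_cond.
  apply: eq_big => [x|x xp].
    by case: (boolP (_ <= x < _)) => //= xp; rewrite mate_dot //; lia.
  by rewrite mate_dot //; lia.
- rewrite /= big_ltn_cond; last lia.
  rewrite mate_open ifT; last by rewrite /=; lia.
  rewrite (@big_cat_nat _ _ _ (p.+1 + tsize t1)) /=; try lia.
  rewrite [X in _ + (_ + X)]big_ltn_cond; last lia.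
  rewrite mate_close ifF; last by rewrite /=; lia.
  rewrite -addnA; congr (_ + (_ + _)).
    rewrite (IH1 p.+1) big_nat_cond [RHS]big_nat_cond.
    apply: eq_big => [x|x xp].
      by case: (boolP (_ <= x < _)) => //= xp; rewrite mate_inside //; lia.
    by rewrite mate_inside //; lia.
  have -> : p + (tsize t1 + tsize t2).+2 = (p.+1 + tsize t1).+1 + tsize t2 by lia.
  rewrite (IH2 (p.+1 + tsize t1).+1) big_nat_cond [RHS]big_nat_cond.
  apply: eq_big => [x|x xp].
    by case: (boolP (_ <= x < _)) => //= xp; rewrite mate_after //; lia.
  by rewrite mate_after //; lia.
Qed.

(* The trees with even arcs of size L, provided that the fuel n is at least L. *)
Fixpoint trees n L : seq tree :=
  match n, L with
  | n'.+1, L'.+1 =>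
      [seq Dot t | t <- trees n' L'] ++
      [seq Arc b u.1 u.2 | b <- [:: false; true],
         u <- [seq u | k <- [seq k <- iota 0 L' | ~~ odd k],
                  u <- [seq (t1, t2) | t1 <- trees n' k, t2 <- trees n' (L'.-1 - k)]]]
  | _, _ => [:: Leaf]
  end.

Lemma treesS n L :
  trees n.+1 L.+1 =
  [seq Dot t | t <- trees n L] ++
  [seq Arc b u.1 u.2 | b <- [:: false; true],
     u <- [seq u | k <- [seq k <- iota 0 L | ~~ odd k],
              u <- [seq (t1, t2) | t1 <- trees n k, t2 <- trees n (L.-1 - k)]]].
Proof. by []. Qed.

Lemma mem_trees n L t : L <= n ->
  (t \in trees n L) = (tsize t == L) && even_arcs t.
Proof.
elim: n L t => [|n IH] [|L] t Ln //.
- by case: t => [|t|b t1 t2]; rewrite mem_seq1 ?eqxx //; case: eqP.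
- by case: t => [|t|b t1 t2]; rewrite mem_seq1 ?eqxx //; case: eqP.
- rewrite treesS mem_cat; case: t => [|t|b t1 t2].
  + by apply/negbTE/negP => /orP[/mapP[]|/allpairsP[? []]].
  + rewrite mem_map; last by move=> ? ? [].
    rewrite IH //; apply/orP/idP => [[//|/allpairsP[? []] //]|]; by left.
  + rewrite (_ : (_ \in map _ _) = false); last by apply/negbTE/mapP => -[].
    rewrite orFb; apply/allpairsP/idP => [[[b' [u1 u2]] [_ H /= [_ -> ->]]]|].
      move: H => /(@allpairsPdep _ (fun=> _))[k [u [+ + E]]]; rewrite -{}E => {u}.
      rewrite mem_filter mem_iota => kP /allpairsP[[v1 v2] /= [+ + [-> ->]]].
      rewrite !IH; lia.
    rewrite /= => H; exists (b, (t1, t2)); split=> //; first by rewrite !inE; case: b {H}.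
    apply/(@allpairsPdep _ (fun=> _)); exists (tsize t1), (t1, t2); split=> //.
      by rewrite mem_filter mem_iota; lia.
    by apply/allpairsP; exists (t1, t2); split=> //=; rewrite IH; lia.
Qed.

Lemma trees_uniq n L : L <= n -> uniq (trees n L).
Proof.
elim: n L => [|n IH] [|L] Ln //.
rewrite treesS cat_uniq; apply/and3P; split.
- by rewrite map_inj_uniq ?IH // => ? ? [].
- by apply/hasPn => t /allpairsP[b [_ _ ->]]; apply/mapP => -[].
- apply: allpairs_uniq => //; last first.
    by move=> [b [u1 u2]] [b' [v1 v2]] _ _ /= [-> -> ->].
  apply: allpairs_uniq_dep.
  + by rewrite filter_uniq // iota_uniq.
  + move=> k; rewrite mem_filter mem_iota => kP.
    apply: allpairs_uniq; try by apply: IH; lia.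
    by move=> [u1 u2] [v1 v2].
  + set st := (X in {in X &, _}).
    (* Sums for different [k] are disjoint: [k] is recovered as the size of the first tree. *)
    have K z : z \in st -> tag z = tsize (tagged z).1.
      move=> /(@allpairsPdep _ (fun=> _))[k [u [+ + ->]]] /=.
      rewrite mem_filter mem_iota => kL /allpairsP[v [+ _ ->]].
      case/and3P: kL => _ _ kL; rewrite mem_trees; first by move=> /andP[/eqP-> _].
      exact: leq_trans (ltnW kL) Ln.
    by move=> [k1 u] [k2 v] /K /= -> /K /= -> ->.
Qed.

Local Open Scope ring_scope.

(** Both sides satisfy the recursion [matchgfS]; the two labels of the root arc together contribute
    ['X + 'X^2]. *)
Lemma sum_trees n L : (L <= n)%N ->
  \sum_(t <- trees n L) 'X^(weight t) = matchgf L \Po ('X + 'X^2).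
Proof.
elim: n L => [|n IH] [|L] Ln //.
- by rewrite big_seq1 matchgf0 rmorph1.
- by rewrite big_seq1 matchgf0 rmorph1.
rewrite treesS big_cat matchgfS comp_polyD comp_polyM comp_polyX raddf_sum.
rewrite big_map IH; last lia.
congr (_ + _).
rewrite big_allpairs_dep big_cons big_seq1 /= -big_split /=.
rewrite big_allpairs_dep big_filter mulr_sumr.
rewrite -(big_mkord (fun k => ~~ odd k)
  (fun k => ('X + 'X^2) * (matchgf k * matchgf (L.-1 - k) \Po ('X + 'X^2)))).
rewrite /index_iota subn0 big_seq_cond [RHS]big_seq_cond.
apply: eq_bigr => k; rewrite mem_iota => /andP[kL _].
rewrite big_allpairs_dep comp_polyM -!IH; try lia.
rewrite big_distrlr mulr_sumr; apply: eq_bigr => t1 _.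
rewrite mulr_sumr; apply: eq_bigr => t2 _ /=.
by rewrite !exprD; ring.
Qed.

(** * Combinatorial data sets as trees *)

Local Open Scope nat_scope.

Lemma comb_dataP d (D : comb_data d) :
  [/\ involutive (invol D), [disjoint Hset D & Tset D],
      Hset D :|: Tset D = [set l | invol D l != l],
      forall l, ((invol D l \in Hset D) = (l \in Hset D)) *
                ((invol D l \in Tset D) = (l \in Tset D)) &
      (forall l, invol D l != l -> odd l != odd (invol D l)) /\
      forall a b : dir d, ~~ [&& a < b, b < invol D a & invol D a < invol D b]].
Proof.
rewrite /invol /Hset /Tset; case: D => -[i [H T]] /=.
move=> /and5P[/forallP iK HT /eqP HU /forallP odd_i /andP[/forallP nc /forallP lab]].
have {}iK l : i (i l) = l by exact/eqP.
split=> // [l|]; last first.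
  split=> [l|a b]; first by move/(implyP (odd_i l)).
  by have /forallP := nc a; exact.
have memU k : (k \in H) || (k \in T) = (i k != k) by rewrite -in_setU HU inE.
have memI k : (k \in H) && (k \in T) = false.
  by case: (boolP (k \in H)) => //= kH; apply: (disjointFr HT).
have := lab l; have := memU l; have := memU (i l); have := memI l; have := memI (i l).
rewrite iK [l == _]eq_sym.
by case: (i l == l); case: (l \in H); case: (l \in T); case: (i l \in H);
  case: (i l \in T).
Qed.

Lemma npairs_open d (D : comb_data d) (A : {set dir d}) :
  (forall l, (invol D l \in A) = (l \in A)) ->
  (forall l, l \in A -> invol D l != l) ->
  npairs D A = #|[set l in A | l < invol D l]|.
Proof.
move=> Ai Afix; have [iK _ _ _ _] := comb_dataP D.
have -> : npairs D A = #|[set [set l; invol D l] | l in [set l in A | l < invol D l]]|.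
  congr #|pred_of_set _|; apply/setP => X; apply/imsetP/imsetP => -[l lA ->].
    have [li|il|E] := ltngtP l (invol D l).
    - by exists l; rewrite // inE lA.
    - exists (invol D l); first by rewrite inE Ai iK lA.
      by rewrite iK setUC.
    - by have := Afix _ lA; rewrite -val_eqE /= -E eqxx.
  by move: lA; rewrite inE => /andP[lA _]; exists l.
rewrite card_in_imset // => l k; rewrite !inE => /andP[_ li] /andP[_ ki] /setP E.
have := E l; have := E k; rewrite !inE !eqxx /= [k == l]eq_sym.
case: (eqVneq l k) => //= _ /eqP kE /esym/eqP lE.
by move: li ki; rewrite -kE -lE; lia.
Qed.

Lemma data_dimE d (D : comb_data d) :
  data_dim D = \sum_(l : dir d | l < invol D l) (l \in Tset D).+1.
Proof.
have [iK HT HU lab _] := comb_dataP D.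
have fixH l : l \in Hset D -> invol D l != l.
  by move=> lH; have := in_setU l (Hset D) (Tset D); rewrite lH HU inE.
have fixT l : l \in Tset D -> invol D l != l.
  by move=> lT; have := in_setU l (Hset D) (Tset D); rewrite lT HU inE orbT.
rewrite /data_dim !npairs_open //; try by move=> l; rewrite lab.
rewrite -!sum1_card big_distrr /=.
rewrite [X in X + _]big_mkcond [X in _ + X]big_mkcond [RHS]big_mkcond -big_split.
apply: eq_bigr => l _ /=.
rewrite !inE; have := in_setU l (Hset D) (Tset D); rewrite HU inE.
case: (boolP (l \in Hset D)) => lH /=.
  rewrite (disjointFr HT lH) /= => _; by case: ltnP.
case: (boolP (l \in Tset D)) => lT /=; first by case: ltnP.
by move=> /negbFE/eqP ->; rewrite ltnn.
Qed.

(** Label false is shared by H-arcs and unmatched points, hence the extra test in the first set. The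
    default of [insubd] is not reached when [t] has even arcs and size [2 * d - 2]. *)
Definition tree_data d t : pre_data d :=
  ([ffun l : dir d => insubd l (mate t 0 l).1],
   ([set l : dir d | ((mate t 0 l).1 != l) && ~~ (mate t 0 l).2],
    [set l : dir d | (mate t 0 l).2])).

Lemma val_tree_data d t (l : dir d) : even_arcs t -> tsize t = 2 * d - 2 ->
  (tree_data d t).1 l = (mate t 0 l).1 :> nat.
Proof.
move=> /(mate_matching 0)[fP _] ts; rewrite ffunE val_insubd ifT //.
have := ltn_ord l; have [] := fP l; last by lia.
by have := ltn_ord l; lia.
Qed.

Lemma tree_data_proof d t : even_arcs t -> tsize t = 2 * d - 2 ->
  is_comb_data (tree_data d t).
Proof.
move=> et ts; have iE l := val_tree_data l et ts.
move: iE; rewrite /tree_data /=; set i := finfun _ => iE.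
have [fP nc] := mate_matching 0 et; rewrite ts add0n in fP nc.
have {}fP (l : dir d) := fP l (ltn_ord l).
have fi l : mate t 0 (i l) = (val l, (mate t 0 l).2).
  by rewrite iE; have [] := fP l.
apply/and5P; split; last (apply/andP; split).
- by apply/forallP => l; rewrite -val_eqE /= iE fi.
- rewrite -setI_eq0; apply/eqP/setP => l; rewrite !inE.
  by case: (mate t 0 l).2; rewrite ?andbF.
- apply/eqP/setP => l; rewrite !inE -val_eqE /= iE.
  have [_ _ + _] := fP l.
  by case: eqP => [E /(_ E) ->|//]; case: (mate t 0 l).2.
- apply/forallP => l; apply/implyP; rewrite -val_eqE /= iE.
  by have [_ _ _ +] := fP l => + /eqP; exact.
- by apply/forallP => a; apply/forallP => b; rewrite !iE; apply: nc; rewrite ltn_ord.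
- apply/forallP => l; apply/implyP; rewrite -val_eqE /= iE !inE fi /= iE.
  by move=> H; rewrite [_ == (mate t 0 l).1]eq_sym H; case: (mate t 0 l).2.
Qed.

Lemma tree_data_inj d t t' : even_arcs t -> even_arcs t' ->
  tsize t = 2 * d - 2 -> tsize t' = 2 * d - 2 ->
  tree_data d t = tree_data d t' -> t = t'.
Proof.
move=> et et' ts ts' E; apply: (@eq_mate _ _ 0) => //; rewrite ?ts //.
move=> x xd; have xlt : x < 2 * d - 2 by lia.
pose l : dir d := Ordinal xlt.
have := val_tree_data l et ts; have := val_tree_data l et' ts'; rewrite E => -> E1.
have : (l \in (tree_data d t).2.2) = (l \in (tree_data d t').2.2) by rewrite E.
rewrite !inE /= => E2.
by rewrite [LHS]surjective_pairing [RHS]surjective_pairing E1 E2.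
Qed.

Lemma tree_data_surj d (D : comb_data d) :
  exists t, [/\ even_arcs t, tsize t = 2 * d - 2 & tree_data d t = data_val D].
Proof.
have [iK HT HU lab [odd_i nc]] := comb_dataP D.
pose f x := if insub x is Some l then (val (invol D l), l \in Tset D) else (x, false).
have fE (l : dir d) : f l = (val (invol D l), l \in Tset D) by rewrite /f valK.
have memT l : l \in Tset D -> invol D l != l.
  by move=> lT; have := in_setU l (Hset D) (Tset D); rewrite lT HU inE orbT.
have [] := @mate_surj 0 (2 * d - 2) f.
  split=> [x xd|x y xd yd].
    have xlt : x < 2 * d - 2 by lia.
    rewrite -[x]/(val (Ordinal xlt : dir d)); move: (Ordinal xlt) => l.
    rewrite !fE /= iK lab ltn_ord; split=> //.
    + by move=> E; apply/negbTE/negP => /memT; rewrite -val_eqE /= E eqxx.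
    + by move=> /eqP/odd_i.
  have xlt : x < 2 * d - 2 by lia.
  have ylt : y < 2 * d - 2 by lia.
  rewrite -[x]/(val (Ordinal xlt : dir d)) -[y]/(val (Ordinal ylt : dir d)) !fE.
  exact: nc.
move=> t [ts et tf]; exists t; split=> //.
have mE (l : dir d) : mate t 0 l = (val (invol D l), l \in Tset D).
  by rewrite tf ?fE // ltn_ord.
rewrite [data_val D]surjective_pairing [X in (_, X)]surjective_pairing.
congr (_, (_, _)).
- by apply/ffunP => l; apply: val_inj; have := val_tree_data l et ts; rewrite mE.
- apply/setP => l; rewrite !inE mE /=.
  have := in_setU l (Hset D) (Tset D); rewrite HU inE val_eqE => ->.
  case: (boolP (l \in Tset D)) => lT; last by rewrite orbF andbT.
  by rewrite andbF (disjointFl HT lT).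
- by apply/setP => l; rewrite !inE mE.
Qed.

Lemma data_dim_tree d (D : comb_data d) t : even_arcs t -> tsize t = 2 * d - 2 ->
  tree_data d t = data_val D -> data_dim D = weight t.
Proof.
move=> et ts E; rewrite data_dimE (weight_mate t 0) ts add0n big_mkord.
have iE l : val (invol D l) = (mate t 0 l).1 by rewrite -(val_tree_data l et ts) E.
apply: eq_big => l; rewrite ?iE // => _.
by rewrite /Tset -E inE.
Qed.

Local Open Scope ring_scope.

Lemma sum_data_dim d :
  \sum_(D : comb_data d) 'X^(data_dim D) = matchgf (2 * d - 2) \Po ('X + 'X^2).
Proof.
rewrite -(sum_trees (leqnn _)).
set s := trees _ _.
have sP t : t \in s -> even_arcs t /\ tsize t = (2 * d - 2)%N.
  by rewrite mem_trees // => /andP[/eqP].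
have dP t : t \in s -> exists2 D : comb_data d, tree_data d t = data_val D &
    insub (tree_data d t) = Some D.
  move=> /sP[et ts]; case: (@insubP _ _ (comb_data d) (tree_data d t)) => [D _ <-|].
    by exists D.
  by rewrite tree_data_proof.
rewrite -[LHS]big_enum.
rewrite (perm_big (pmap insub [seq tree_data d t | t <- s])) /=; last first.
  apply: uniq_perm; first exact: enum_uniq.
    apply: pmap_sub_uniq; rewrite map_inj_in_uniq ?trees_uniq //.
    move=> t t' /sP[et ts] /sP[et' ts']; exact: tree_data_inj.
  move=> D; rewrite mem_enum mem_pmap_sub; apply/esym/mapP.
  have [t [et ts E]] := tree_data_surj D; exists t => //.
  by rewrite mem_trees // ts eqxx et.
rewrite big_pmap big_map; apply: eq_big_seq => t ts.
by have [D E ->] := dP _ ts; rewrite /= (data_dim_tree _ _ E) //; have [] := sP _ ts.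
Qed.

Lemma num_dataE d q :
  (num_data d q)%:R = (matchgf (2 * d - 2) \Po ('X + 'X^2))`_q :> rat.
Proof.
rewrite -sum_data_dim coef_sum /num_data -sum1_card natr_sum big_mkcond.
by apply: eq_bigr => D _; rewrite coefXn inE eq_sym; case: eqP.
Qed.

(** * The hypergeometric coefficients *)

Lemma pochhammerN n k : pochhammer (- n%:R) k = (-1) ^+ k * (n ^_ k)%:R.
Proof.
rewrite /pochhammer; elim: k => [|k IH]; first by rewrite big_ord0 mul1r.
rewrite big_ord_recr IH /= ffactnSr exprS natrM.
(* The factor [n - k] is truncated in [nat], but for [n < k] the falling factorial is already 0. *)
have [nk|kn] := ltnP n k; first by rewrite ffact_small // !(mul0r, mulr0).
by rewrite natrB //; ring.
Qed.

Lemma pochhammer2 k : pochhammer 2 k = k.+1`!%:R.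
Proof.
rewrite /pochhammer; elim: k => [|k IH]; first by rewrite big_ord0.
rewrite big_ord_recr IH /= [in RHS]factS natrM mulrC; congr (_ * _).
by rewrite -natrD add2n.
Qed.

Lemma pochhammer_coef m k :
  pochhammer (- m%:R) k * pochhammer (- (2 * m)%:R) k / (pochhammer 2 k * k`!%:R) =
  'C(2 * m, k)%:R * 'C(m, k)%:R / k.+1%:R.
Proof.
rewrite !pochhammerN pochhammer2 mulrACA -expr2 sqrr_sign mul1r.
have k0 : k.+1%:R != 0 :> rat by rewrite pnatr_eq0.
have f0 : k`!%:R != 0 :> rat by rewrite pnatr_eq0 -lt0n fact_gt0.
rewrite -!bin_ffact factS !natrM; field.
by rewrite f0 addrC natr1 k0.
Qed.

Lemma hyp2F1_matchgf d : (0 < d)%N ->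
  hyp2F1 d.-1 (2 * (1 - d%:R)) 2 = matchgf (2 * d - 2).
Proof.
case: d => // m _.
have -> : 2 * (1 - m.+1%:R) = - (2 * m)%:R :> rat by rewrite natrM -natr1; ring.
have -> : (2 * m.+1 - 2 = 2 * m)%N by lia.
apply/polyP => k; rewrite matchgf_double /hyp2F1 /= coef_sum.
have [km|mk] := ltnP k m.+1.
  rewrite (bigD1 (Ordinal km)) //= coefZ coefXn eqxx mulr1 pochhammer_coef.
  rewrite big1 ?addr0 // => i /negbTE ik; rewrite coefZ coefXn.
  by rewrite -val_eqE /= eq_sym in ik; rewrite ik mulr0.
rewrite [in RHS](@bin_small m) // mulr0 mul0r big1 // => i _.
by rewrite coefZ coefXn gtn_eqF ?mulr0 // (leq_trans (ltn_ord i)).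
Qed.

(** Factor the power as ['X^n * (1 + 'X)^n]; for [q < n] the shifted index is negative. *)
Lemma coef_XX2 n q : (('X + 'X^2 : {poly rat}) ^+ n)`_q = (binz n (q%:Z - n%:Z))%:R.
Proof.
have -> : 'X + 'X^2 = 'X * (1 + 'X) :> {poly rat} by ring.
rewrite exprMn coefXnM addrC; case: ltnP => H.
  rewrite (_ : binz _ _ = 0%N) //.
  by have -> : q%:Z - n%:Z = Negz (n - q).-1 by lia.
rewrite subzn // exprD1n coef_sum /=.
have [kn|nk] := ltnP (q - n) n.+1.
  rewrite (bigD1 (Ordinal kn)) //= coefMn coefXn eqxx big1 ?addr0 // => i /negbTE.
  by rewrite -val_eqE /= eq_sym => ik; rewrite coefMn coefXn ik mul0rn.
rewrite bin_small // big1 // => i _.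
by rewrite coefMn coefXn gtn_eqF ?mul0rn // (leq_trans (ltn_ord i)).
Qed.

Lemma num_data_hyp2F1 d q : (0 < d)%N ->
  (num_data d q)%:R = (hyp2F1 d.-1 (2 * (1 - d%:R)) 2 \Po ('X + 'X^2))`_q.
Proof. by move=> d0; rewrite hyp2F1_matchgf // num_dataE. Qed.

Lemma num_data_sum d q : (0 < d)%N ->
  (num_data d q)%:R =
        \sum_(0 <= n < d)
          pochhammer (2 - 2 * d%:R) n * pochhammer (1 - d%:R) n
          / (pochhammer 2 n * n`!%:R) * (binz n (q%:Z - n%:Z))%:R.
Proof.
move=> d0; rewrite num_data_hyp2F1 // /hyp2F1 raddf_sum coef_sum big_mkord prednK //.
apply: eq_bigr => i _ /=.
rewrite comp_polyZ comp_Xn_poly coefZ coef_XX2; congr (_ / _ * _).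
rewrite mulrC; congr (pochhammer _ _ * pochhammer _ _); first by ring.
by rewrite -[in RHS](prednK d0) -natr1; ring.
Qed.

(** * Combinatorial classes *)

From mathcomp Require Import boolp classical_sets functions cardinality reals.
From mathcomp Require Import topology normedtype derive trigo.
From mathcomp Require Import complex.

Import numFieldTopology.Exports numFieldNormedType.Exports.

Local Open Scope classical_set_scope.
Local Open Scope card_scope.
Local Open Scope ring_scope.

Lemma linear_section_leq (F : fieldType) (m n : nat)
    (u : {linear 'rV[F]_m -> 'rV[F]_n}) (v : {linear 'rV[F]_n -> 'rV[F]_m}) :
  cancel u v -> (m <= n)%N.
Proof.
move=> uK; have uv1 : lin1_mx u *m lin1_mx v = 1%:M.
  by apply/row_matrixP => i; rewrite !rowE mulmxA !mul_rV_lin1 uK mulmx1.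
have := mulmx_max_rank (lin1_mx u) (lin1_mx v).
by rewrite uv1 mxrank1.
Qed.

(** The transition map [g' \o f] has the local left inverse [g \o f'], so by the chain rule its
    differential is an injective linear map from dimension [m] to dimension [n]. *)
Lemma submanifold_dim_leq (R : realType) (V : normedModType R) (S : set V) (m n : nat) :
  S !=set0 -> submanifold S m -> submanifold S n -> (m <= n)%N.
Proof.
move=> [p Sp] /(_ p Sp)[U [W [f [g [[oU Up] [oW fW] gf df dg]]]]].
move=> /(_ p Sp)[U' [W' [f' [g' [[oU' Up'] [oW' fW'] gf' df' dg']]]]].
have [w Ww fwp] : (f @` W) p by rewrite fW.
have [w' Ww' fwp'] : (f' @` W') p by rewrite fW'.
have g'w : g' p = w' by rewrite -fwp' gf'.
have d1 : differentiable (g' \o f) w.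
  by apply: differentiable_comp; [exact: df|apply: dg'; rewrite fwp].
have d2 : differentiable (g \o f') ((g' \o f) w).
  rewrite /= fwp g'w.
  by apply: differentiable_comp; [exact: df'|apply: dg; rewrite fwp'].
(* Continuity of [f] keeps [f x] in [U'] near [w], hence in the image of [f'], where [f' \o g'] is
   the identity. *)
have id_near : \near w, (g \o f') ((g' \o f) w) = id w.
  have nW : \near w, W w by exact: open_nbhs_nbhs.
  have nU : \near w, U' (f w).
    apply: (differentiable_continuous (df _ Ww)).
    by rewrite /= fwp; apply: open_nbhs_nbhs.
  near=> x; have Wx : W x by near: x.
  have U'x : U' (f x) by near: x.
  have /= SU : (S `&` U) (f x) by rewrite -fW; exists x.
  have : (f' @` W') (f x) by rewrite fW'; split => //; case: SU.
  by move=> [y W'y fy]; rewrite /= -fy gf' // fy gf.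
apply: (@linear_section_leq _ _ _ ('d (g' \o f) w) ('d (g \o f') ((g' \o f) w))) => v.
have := @near_eq_derive _ _ _ ((g \o f') \o (g' \o f)) id w v id_near.
rewrite derive_id deriveE; last exact: differentiable_comp.
by rewrite (@diff_comp _ _ _ _ (g' \o f) (g \o f')).
Unshelve. all: by end_near. Qed.

(* The hypothesis is only about odd k, but i and i' exchange the parities. *)
Lemma pairs_transfer d (i i' : dir d -> dir d) (A A' : {set dir d}) :
  involutive i -> involutive i' -> (forall l, (i l \in A) = (l \in A)) ->
  (forall l, (i' l \in A') = (l \in A')) ->
  (forall l, l \in A -> odd l != odd (i l)) ->
  (forall k j : dir d, odd k -> ~~ odd j ->
     (k \in A) && (i k == j) -> (k \in A') && (i' k == j)) ->
  forall l, l \in A -> l \in A' /\ i' l = i l.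
Proof.
move=> iK iK' iA iA' oA H l lA; have := oA l lA.
case: (boolP (odd l)) => ol oil.
  by have := H l (i l) ol; rewrite lA eqxx => /(_ _ isT)/andP[|-> /eqP->] //;
    case: odd oil.
have := H (i l) l _ ol; rewrite iA lA iK eqxx => /(_ _ isT)/andP[|].
  by case: odd oil.
move=> ilA /eqP E; move: ilA; rewrite -iA' E => ->; split=> //.
by rewrite -[in LHS]E iK'.
Qed.

Lemma has_data_transfer (R : realType) d (P : {poly R[i]}) (D D' : comb_data d) :
  has_data P D -> has_data P D' -> forall l,
  (l \in Hset D -> l \in Hset D' /\ invol D' l = invol D l) /\
  (l \in Tset D -> l \in Tset D' /\ invol D' l = invol D l).
Proof.
move=> hD hD' l.
have [iK HT HU lab [odd_i nc]] := comb_dataP D.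
have [iK' _ _ lab' _] := comb_dataP D'.
have memU k : (k \in Hset D) || (k \in Tset D) = (invol D k != k).
  by rewrite -finset.in_setU HU finset.inE.
split; move: l; apply: pairs_transfer => // [k|k|k kA|k j ok oj];
  rewrite ?lab ?lab' //.
- by apply: odd_i; rewrite -memU kA.
- by move=> /(hD k j ok oj).1/(hD' k j ok oj).1.
- by apply: odd_i; rewrite -memU kA orbT.
- by move=> /(hD k j ok oj).2/(hD' k j ok oj).2.
Qed.

Lemma has_data_inj (R : realType) d (P : {poly R[i]}) (D D' : comb_data d) :
  has_data P D -> has_data P D' -> D = D'.
Proof.
move=> hD hD'; have HD := has_data_transfer hD hD'; have HD' := has_data_transfer hD' hD.
have eH : Hset D = Hset D'.
  by apply/setP => l; apply/idP/idP => [/(HD l).1[]|/(HD' l).1[]].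
have eT : Tset D = Tset D'.
  by apply/setP => l; apply/idP/idP => [/(HD l).2[]|/(HD' l).2[]].
(* Off the common union of H and T both involutions fix [l]. *)
have ei l : invol D l = invol D' l.
  have [_ _ HU _ _] := comb_dataP D; have [_ _ HU' _ _] := comb_dataP D'.
  have := finset.in_setU l (Hset D) (Tset D).
  have := finset.in_setU l (Hset D') (Tset D').
  rewrite HU HU' !finset.inE -eH -eT => + E; rewrite -E.
  case: (eqVneq (invol D l) l) E => [-> _ /negbFE/eqP -> //|_ /esym/orP[]].
  - by move=> /(HD l).1[].
  - by move=> /(HD l).2[].
apply: val_inj; case: D D' eH eT ei {hD hD' HD HD'} => -[i [H T]] ? [[i' [H' T']] ?].
rewrite /Hset /Tset /invol /= => -> -> ei; congr (_, _).
exact/ffunP.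
Qed.

(** Nonemptiness makes [comb_class] injective on data sets and, by uniqueness of dimension, forces
    [data_dim D = q] for a class of dimension [q]. *)
Lemma card_comb_classes (R : realType) (d q : nat) :
  (forall D : comb_data d, comb_class R D !=set0) ->
  (forall D : comb_data d, submanifold (comb_class R D) (data_dim D)) ->
  comb_classes R d q #= `I_(num_data d q).
Proof.
move=> ne sm; pose A := [set D : comb_data d | data_dim D == q]%SET.
have -> : comb_classes R d q = [set comb_class R (enum_val i) | i in [set: 'I_#|A|]].
  apply/seteqP; split=> [S [D [-> DS Dq]]|_ [i _ <-]].
    have DA : D \in A.
      by rewrite finset.inE eqn_leq !(submanifold_dim_leq DS).
    by exists (enum_rank_in DA D); rewrite ?enum_rankK_in.
  exists (enum_val i); split => //.
  by have := enum_valP i; rewrite finset.inE => /eqP <-.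
apply: (@card_eq_trans _ _ _ _ [set: 'I_#|A|]).
  apply: inj_card_eq => i j _ _ eC; apply: enum_val_inj.
  have [a ai] := ne (enum_val i).
  by apply: (has_data_inj ai); move: ai; rewrite eC.
by rewrite card_eq_sym card_II.
Qed.

Theorem theorem4p3 (R : realType) (d q : nat) (hd : (2 <= d)%N) :
  [/\ (forall D : comb_data d, comb_class R D !=set0) ->
      (forall D : comb_data d, submanifold (comb_class R D) (data_dim D)) ->
      comb_classes R d q #= `I_(num_data d q),
      (num_data d q)%:R =
        (hyp2F1 d.-1 (2 * (1 - d%:R)) 2 \Po ('X + 'X^2))`_q &
      (num_data d q)%:R =
        \sum_(0 <= n < d)
          pochhammer (2 - 2 * d%:R) n * pochhammer (1 - d%:R) n
          / (pochhammer 2 n * n`!%:R) * (binz n (q%:Z - n%:Z))%:R].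
Proof.
have d0 : (0 < d)%N by exact: ltnW.
by split; [exact: card_comb_classes|exact: num_data_hyp2F1|exact: num_data_sum].
Qed.
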